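(* Consider a class of clean packages $D_k^{\mathrm{cl}}$ at scale $k$ with clean gauge class $\Gamma_{\Lambda,k}^{\mathrm{cl}}$, clean distance $\operatorname{dist}_{\mathrm{cl}}$ and clean detector $M_{\Lambda,k}^{\mathrm{comp}}\ge0$. Assume: (a) the clean class is stable under quotient normalization; (b) the clean unit quotient section $S_{\Lambda,k}^{\mathrm{cl}}:=\{D_k^{\mathrm{cl}}:\operatorname{dist}_{\mathrm{cl}}(D_k^{\mathrm{cl}},\Gamma_{\Lambda,k}^{\mathrm{cl}})=1\}$ is compact; (c) $M_{\Lambda,k}^{\mathrm{comp}}$ is lower semicontinuous and positively homogeneous; (d) clean kernel-freeness holds: $\{D_k^{\mathrm{cl}}:M_{\Lambda,k}^{\mathrm{comp}}(D_k^{\mathrm{cl}})=0\}\subset\Gamma_{\Lambda,k}^{\mathrm{cl}}$. Then $$\mu_{\Lambda,k}^{\mathrm{comp}}:=\inf_{D_k^{\mathrm{cl}}\in S_{\Lambda,k}^{\mathrm{cl}}}M_{\Lambda,k}^{\mathrm{comp}}(D_k^{\mathrm{cl}})>0,$$ and for every clean package $D_k^{\mathrm{cl}}$ in the class, $$M_{\Lambda,k}^{\mathrm{comp}}(D_k^{\mathrm{cl}})\ge\mu_{\Lambda,k}^{\mathrm{comp}}\operatorname{dist}_{\mathrm{cl}}(D_k^{\mathrm{cl}},\Gamma_{\Lambda,k}^{\mathrm{cl}}).$$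
   Context: A clean package is a tuple $D_k^{\mathrm{cl}}=(P_k^{\mathrm{act},\mathrm{cl}},P_k^{\mathrm{harm},\mathrm{cl}},S_k^{\mathrm{cl}},G_k^{\mathrm{cl}},O_k^{\mathrm{cl}})$ (active pressure, harmonic pressure, source, gate, observation coordinates) in a normed space. The clean detector is $$M_{\Lambda,k}^{\mathrm{comp}}=\|O_k^{\mathrm{cl}}\|_{\mathcal O}+\beta_{\mathrm{prs}}\mathsf{Tax}_{\mathrm{prs}}^{\mathrm{cl}}+\beta_{\mathrm{harm}}\mathsf{Tax}_{\mathrm{harm}}^{\mathrm{cl}}+\beta_{\mathrm{gate}}\mathsf{Tax}_{\mathrm{gate}}^{\mathrm{cl}}+\beta_{\mathrm{det}}\mathsf{Tax}_{\mathrm{det}}^{\mathrm{cl}},$$ each term evaluated at $D_k^{\mathrm{cl}}$, with given nonnegative tax functionals and all active weights $\beta$ positive. ''Stable under quotient normalization'' means: if $d:=\operatorname{dist}_{\mathrm{cl}}(D,\Gamma_{\Lambda,k}^{\mathrm{cl}})>0$ then $d^{-1}D$ is in the class and has clean distance $1$ to $\Gamma_{\Lambda,k}^{\mathrm{cl}}$. Positive homogeneity: $M(tD)=tM(D)$ for $t>0$. The infimum over an empty set is $+\infty$, with $(+\infty)\cdot0=0$. *)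

(* Defs.v *)
From HB Require Import structures.
From mathcomp Require Import all_boot all_order all_algebra.
From mathcomp Require Import all_classical all_reals all_analysis.
Set Implicit Arguments.
Unset Strict Implicit.
Unset Printing Implicit Defensive.
Import Order.TTheory GRing.Theory Num.Theory.
Import numFieldNormedType.Exports.
Local Open Scope classical_set_scope.
Local Open Scope ring_scope.

(* Conventions.  The cutoff Lambda and the scale k are fixed throughout.
   The packages (active pressure, harmonic pressure, source, gate,
   observation) form a vector space [V] of 5-tuples carrying an arbitrary
   norm: an injective linear map [tup] from [V] to the product of the
   coordinate spaces returns the tuple, so that the norm of [V] need not be
   the max norm that the library puts on products.  The class of clean
   packages is a set [C : set V], the gauge class a set [Gamma : set V]. *)

Definition obs (R : realType) (Pact Pharm Src Gate : lmodType R)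
    (Obs : normedModType R) (V : normedModType R)
    (tup : V -> Pact * Pharm * Src * Gate * Obs) (D : V) : Obs :=
  let: (_, _, _, _, o) := tup D in o.

Definition detector (R : realType) (Pact Pharm Src Gate : lmodType R)
    (Obs : normedModType R) (V : normedModType R)
    (tup : V -> Pact * Pharm * Src * Gate * Obs)
    (beta_prs beta_harm beta_gate beta_det : R)
    (Tax_prs Tax_harm Tax_gate Tax_det : V -> R) (D : V) : R :=
  `|obs tup D| + beta_prs * Tax_prs D + beta_harm * Tax_harm D
    + beta_gate * Tax_gate D + beta_det * Tax_det D.

Definition clean_dist (R : realType) (V : normedModType R) (D : V)
    (Gamma : set V) : \bar R :=
  edist_inf Gamma D.

Lemma edist_norm (R : realType) (V : normedModType R) (x y : V) :
  edist (x, y) = `|x - y|%:E.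
Proof.
apply/eqP; rewrite eq_le; apply/andP; split.
  apply/lee_addgt0Pr => e e0; apply: ereal_inf_lbound.
  exists (`|x - y| + e) => //=; split.
    by rewrite ltr_wpDl.
  by rewrite -ball_normE /= ltrDl.
apply: le_ereal_inf_tmp => _ [r [_ /=]] + <-.
by rewrite -ball_normE /= lee_fin => /ltW.
Qed.

Lemma clean_distE (R : realType) (V : normedModType R) (D : V)
    (Gamma : set V) :
  clean_dist D Gamma = ereal_inf [set `|D - g|%:E | g in Gamma].
Proof.
rewrite /clean_dist /edist_inf; congr ereal_inf.
by apply: eq_imagel => g _; exact: edist_norm.
Qed.

(* If [Gamma] is empty the distance is +oo, [fine] sends it to 0 and the
   rescaled package is 0, again at distance +oo: a nonempty class is then not
   stable. *)
Definition quotient_stable (R : realType) (V : normedModType R)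
    (C Gamma : set V) : Prop :=
  forall D, C D -> (0 < clean_dist D Gamma)%E ->
    let D1 := (fine (clean_dist D Gamma))^-1 *: D in
    C D1 /\ clean_dist D1 Gamma = 1%E.

Definition unit_section (R : realType) (V : normedModType R)
    (C Gamma : set V) : set V :=
  [set D | C D /\ clean_dist D Gamma = 1%E].

(* Semicontinuity for the topology induced on [C]. *)
Definition lsc_on (R : realType) (V : normedModType R) (C : set V)
    (M : V -> R) : Prop :=
  lower_semicontinuous ((fun D => (M D)%:E) : subspace C -> \bar R).

(* [C] is not assumed to be a cone, hence the guard on [t *: D]. *)
Definition pos_homogeneous_on (R : realType) (V : normedModType R)
    (C : set V) (M : V -> R) : Prop :=
  forall (t : R) (D : V), 0 < t -> C D -> C (t *: D) -> M (t *: D) = t * M D.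

Definition kernel_free (R : realType) (V : normedModType R)
    (C Gamma : set V) (M : V -> R) : Prop :=
  [set D | C D /\ M D = 0] `<=` Gamma.

Definition margin (R : realType) (V : normedModType R)
    (C Gamma : set V) (M : V -> R) : \bar R :=
  ereal_inf [set (M D)%:E | D in unit_section C Gamma].

(* Main.v *)
(** A lower semicontinuous function which is positive on a compact set is
    bounded below there by a positive constant, and kernel-freeness makes the
    detector positive on the unit section, whose points lie at distance 1 from
    the gauge class. The inequality at a package at distance d > 0 is then the
    bound on the unit section at the package divided by d, multiplied by d. *)
Require Import Defs.
From HB Require Import structures.
From mathcomp Require Import all_boot all_order all_algebra.
From mathcomp Require Import all_classical all_reals all_analysis.
Import Order.TTheory GRing.Theory Num.Theory.
Import numFieldNormedType.Exports.
Local Open Scope classical_set_scope.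
Local Open Scope ring_scope.

(** Near each point [x] of [S], [M] stays above [M x / 2], and compactness merges these local bounds
    into one. No minimiser is extracted, so [S] may be empty. *)
Lemma lsc_on_compact_lbound (R : realType) (V : normedModType R)
    (C S : set V) (M : V -> R) :
  compact S -> S `<=` C -> lsc_on C M -> (forall D, S D -> 0 < M D) ->
  exists2 e : R, 0 < e & forall D, S D -> e <= M D.
Proof.
move=> cS SC lM M0.
have : \forall e \near 0^'+, S `<=` [set D | S D -> e <= M D].
  (* Near-covering form of compactness: it suffices that each [x] has a neighbourhood on which the
     bound holds for all small [e > 0]. *)
  move/compact_near_coveringP: cS; apply => x Sx.
  have /lM[U xU UM] : ((M x / 2)%:E < (M x)%:E)%E.
    by rewrite lte_fin ltr_pdivrMr// ltr_pMr ?M0// ltr1n.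
  have xUC : within C (nbhs x) U by rewrite nbhs_subspace_in//; exact: SC.
  (* [U] is a neighbourhood in [C] only; the guard [C D ->] makes it one in [V]. *)
  exists ([set D | C D -> U D], [set e | e < M x / 2]) => /=.
    by split => //; apply: nbhs_right_lt; rewrite divr_gt0 ?M0.
  move=> [y e] /= [CU ex] Sy; apply/ltW/(lt_trans ex).
  by rewrite -lte_fin; apply/UM/CU/SC.
move=> H; near (0:R)^'+ => e; exists e; first by near: e; exact: nbhs_right_gt.
by move=> D SD; have /(_ D SD SD) : S `<=` [set D | S D -> e <= M D] by near: e.
Unshelve. all: by end_near.
Qed.

(** Finiteness makes [fine] faithful, so that normalization really divides by the distance. *)
Lemma quotient_stable_fin_num (R : realType) (V : normedModType R)
    (C Gamma : set V) (D : V) :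
  quotient_stable C Gamma -> C D -> clean_dist D Gamma \is a fin_num.
Proof.
move=> st CD; have d0 : (0 <= clean_dist D Gamma)%E by exact: edist_inf_ge0.
have [->//|dN0] := eqVneq (clean_dist D Gamma) 0%E.
have [|_] := st D CD; first by rewrite lt0e dN0.
have [->|/set0P[g Gg] _] := eqVneq Gamma set0.
  by rewrite clean_distE image_set0 ereal_inf0.
rewrite ge0_fin_numE// clean_distE (@le_lt_trans _ _ `|D - g|%:E) ?ltry//.
by apply: ereal_inf_lbound; exists g.
Qed.

Lemma detector_ge0 (R : realType) (Pact Pharm Src Gate : lmodType R)
    (Obs : normedModType R) (V : normedModType R)
    (tup : V -> Pact * Pharm * Src * Gate * Obs)
    (beta_prs beta_harm beta_gate beta_det : R)
    (Tax_prs Tax_harm Tax_gate Tax_det : V -> R) (D : V) :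
  0 <= beta_prs -> 0 <= beta_harm -> 0 <= beta_gate -> 0 <= beta_det ->
  0 <= Tax_prs D -> 0 <= Tax_harm D -> 0 <= Tax_gate D -> 0 <= Tax_det D ->
  0 <= detector tup beta_prs beta_harm beta_gate beta_det
         Tax_prs Tax_harm Tax_gate Tax_det D.
Proof. by move=> *; rewrite /detector !addr_ge0// mulr_ge0. Qed.

Lemma margin_gt0 (R : realType) (V : normedModType R) (C Gamma : set V)
    (M : V -> R) :
  (forall D, C D -> 0 <= M D) -> compact (unit_section C Gamma) ->
  lsc_on C M -> kernel_free C Gamma M -> (0 < margin C Gamma M)%E.
Proof.
move=> M0 cS lM kf.
have [||e e0 eM] := lsc_on_compact_lbound _ _ _ _ _ cS _ lM.
- by move=> D [].
- move=> D [CD dD]; rewrite lt_def M0// andbT; apply/eqP => MD0.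
  have := edist_inf0 (kf D (conj CD MD0)).
  by rewrite -/(clean_dist D Gamma) dD => /eqP; rewrite eqe oner_eq0.
(* Comparing with the constant [e] also covers an empty section, whose infimum is [+oo]. *)
apply: (@lt_le_trans _ _ e%:E); first by rewrite lte_fin.
by apply: le_ereal_inf_tmp => _ [D SD <-]; rewrite lee_fin eM.
Qed.

Lemma margin_dist_le (R : realType) (V : normedModType R) (C Gamma : set V)
    (M : V -> R) (D : V) :
  (forall D, C D -> 0 <= M D) -> quotient_stable C Gamma ->
  pos_homogeneous_on C M -> C D ->
  (margin C Gamma M * clean_dist D Gamma <= (M D)%:E)%E.
Proof.
move=> M0 st ph CD.
have dfin := quotient_stable_fin_num _ _ _ _ _ st CD.
have d0 : (0 <= clean_dist D Gamma)%E by exact: edist_inf_ge0.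
(* At distance 0 the product is 0 even if the margin is [+oo], and [M D] is nonnegative. *)
have [->|dN0] := eqVneq (clean_dist D Gamma) 0%E.
  by rewrite mule0 lee_fin M0.
have dgt0 : (0 < clean_dist D Gamma)%E by rewrite lt0e dN0.
have [CD1 dD1] := st D CD dgt0.
have fgt0 : 0 < fine (clean_dist D Gamma) by rewrite -lte_fin fineK.
have le_margin : (margin C Gamma M <=
    (M ((fine (clean_dist D Gamma))^-1 *: D))%:E)%E.
  by apply: ereal_inf_lbound; exists ((fine (clean_dist D Gamma))^-1 *: D).
(* With [d] the distance, homogeneity at [t = d^-1] turns the right-hand side into [d^-1 * M D * d],
   which is [M D]. *)
apply: le_trans (lee_wpmul2r d0 le_margin) _.
rewrite ph ?invr_gt0// -[X in (_ * X)%E](fineK dfin) -EFinM lee_fin.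
by rewrite mulrAC mulVf ?mul1r// gt_eqF.
Qed.

Theorem theorem12p15 (R : realType)
    (Pact Pharm Src Gate : lmodType R) (Obs : normedModType R)
    (V : normedModType R)
    (tup : {linear V -> (Pact * Pharm * Src * Gate * Obs)%type})
    (tup_inj : injective tup)
    (C Gamma : set V)
    (beta_prs beta_harm beta_gate beta_det : R)
    (beta_prs_gt0 : 0 < beta_prs) (beta_harm_gt0 : 0 < beta_harm)
    (beta_gate_gt0 : 0 < beta_gate) (beta_det_gt0 : 0 < beta_det)
    (Tax_prs Tax_harm Tax_gate Tax_det : V -> R)
    (Tax_prs_ge0 : forall D, C D -> 0 <= Tax_prs D)
    (Tax_harm_ge0 : forall D, C D -> 0 <= Tax_harm D)
    (Tax_gate_ge0 : forall D, C D -> 0 <= Tax_gate D)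
    (Tax_det_ge0 : forall D, C D -> 0 <= Tax_det D) :
  let M := detector tup beta_prs beta_harm beta_gate beta_det
             Tax_prs Tax_harm Tax_gate Tax_det in
  quotient_stable C Gamma ->
  compact (unit_section C Gamma) ->
  lsc_on C M ->
  pos_homogeneous_on C M ->
  kernel_free C Gamma M ->
  (0 < margin C Gamma M)%E /\
  (forall D, C D -> (margin C Gamma M * clean_dist D Gamma <= (M D)%:E)%E).
Proof.
move=> M st cS lM ph kf.
have M0 D : C D -> 0 <= M D.
  move=> CD; have := (Tax_prs_ge0 D CD, Tax_harm_ge0 D CD).
  have := (Tax_gate_ge0 D CD, Tax_det_ge0 D CD) => -[? ?] -[? ?].
  by apply: detector_ge0 => //; exact: ltW.
by split=> [|D CD]; [exact: margin_gt0|exact: margin_dist_le].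
Qed.
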